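(* In the setting of the context, suppose that $f^\dagger\in X$ satisfies $\mathrm{VSC}^3(f^\dagger,\Phi,\mathcal R,\mathcal S)$ with elements $\overline p\in Y^*$, $\overline\omega\in X$ and constants $\beta\ge0$, $\mu>1$, $\overline t>0$, that $\|g^{\mathrm{obs}}-Tf^\dagger\|\le\delta$ with $\delta>0$, and that $c^{-1}\delta\le\alpha^{q^*-1}\le\overline t$ for some $c>0$. Define $\widetilde\Phi(s):=\Phi(s^{q/r})$. Then $$\Delta_{\mathcal R}^{T^*\overline p}\left(\hat f_\alpha^{(2)},f^\dagger\right)\le C\left(\frac{\delta^q}{\alpha}+\alpha^{2(q^*-1)}\left(-\widetilde\Phi\right)^*\left(\frac{\tilde C\,(c+\|T\overline\omega\|)^{q-r}}{-\alpha^{q^*-1}}\right)+\beta\,\alpha^{2\mu(q^*-1)}\right)$$ with constants $C,\tilde C>0$ depending at most on $q$, $r$, $c$, $c_{q,Y}$ and $c_{q^*,Y^*}$.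
   Context: Setting: $X,Y$ are real Banach spaces, $T:X\to Y$ is bounded, linear and injective, $T^{-1}:T(X)\to X$ is not continuous. Let $1<q\le2\le r<\infty$ and let $Y$ be $q$-smooth and $r$-convex, i.e. there is $K>0$ with $\rho_Y(\tau)\le K\tau^q$ for all $\tau>0$ and $\delta_Y(\varepsilon)\ge K^{-1}\varepsilon^r$ for all $\varepsilon\in(0,2]$, where $\delta_Y(\varepsilon)=\inf\{1-\|y+\tilde y\|/2:\|y\|=\|\tilde y\|=1,\|y-\tilde y\|=\varepsilon\}$ and $\rho_Y(\tau)=\sup\{(\|y+\tilde y\|+\|y-\tilde y\|)/2-1:\|y\|=1,\|\tilde y\|=\tau\}$. Let $\mathcal R:X\to(-\infty,\infty]$ be convex, proper, lower semicontinuous, and $\mathcal S(g):=\frac1q\|g\|_Y^q$, so $\mathcal S^*(p)=\frac1{q^*}\|p\|_{Y^*}^{q^*}$, where $\frac1q+\frac1{q^*}=1$. For $f_0^*\in\partial\mathcal R(f_0)$ the Bregman distance is $\Delta_{\mathcal R}^{f_0^*}(f,f_0):=\mathcal R(f)-\mathcal R(f_0)-\langle f_0^*,f-f_0\rangle$; analogously for other convex functionals, and the superscript is omitted when the subdifferential is a singleton. Let $\alpha>0$, $g^{\mathrm{obs}}\in Y$. Assume that $f\mapsto\frac1\alpha\mathcal S(Tf-g^{\mathrm{obs}})+\Delta_{\mathcal R}^{f_0^*}(f,f_0)$ has a unique minimizer for all $(f_0,f_0^* )\in X\times X^*$ with $f_0^*\in\partial\mathcal R(f_0)$. Bregman iteration: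 $\hat f_\alpha$ is the minimizer over $X$ of $\frac1\alpha\mathcal S(Tf-g^{\mathrm{obs}})+\mathcal R(f)$, and $\hat p_\alpha\in Y^*$ is the unique minimizer of $\frac1\alpha\mathcal S^*(-\alpha p)-\langle p,g^{\mathrm{obs}}\rangle+\mathcal R^*(T^*p)$; one has $T^*\hat p_\alpha\in\partial\mathcal R(\hat f_\alpha)$. Then $\hat f_\alpha^{(2)}$ is the minimizer over $X$ of $\frac1\alpha\mathcal S(Tf-g^{\mathrm{obs}})+\Delta_{\mathcal R}^{T^*\hat p_\alpha}(f,\hat f_\alpha)$. An index function is a continuous increasing $\Phi:[0,\infty)\to[0,\infty)$ with $\Phi(0)=0$. For such a function, $(-\Phi)^*(x)=\sup_{\tau\ge0}[x\tau+\Phi(\tau)]$. $\mathrm{VSC}^3(f^\dagger,\Phi,\mathcal R,\mathcal S)$ ($\Phi$ an index function): there exist $\overline p\in Y^*$ and $\overline\omega\in X$ with $T^*\overline p\in\partial\mathcal R(f^\dagger)$ and $T\overline\omega\in\partial\mathcal S^*(\overline p)$, constants $\beta\ge0$, $\mu>1$, $\overline t>0$, and $f_t^*\in\partial\mathcal R(f^\dagger-t\overline\omega)$ for all $0<t\le\overline t$, such that for all $f\in X$ and all $t\in(0,\overline t]$ $$\langle f_t^*-T^*\overline p,\,f^\dagger-t\overline\omega-f\rangle\le\Delta_{\mathcal R}^{f_t^*}(f,f^\dagger-t\overline\omega)+t^2\Phi\left(t^{-q}\|Tf-Tf^\dagger+tT\overline\omega\|^q\right)+\beta t^{2\mu}.$$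 Constants: $c_{q,Y}>0$ is a constant (depending only on $q$ and $Y$) with $\Delta_{\mathcal S}(x,y)\ge c_{q,Y}\max\{\|y\|,\|x-y\|\}^{q-r}\|x-y\|^r$ for all $x,y\in Y$; $c_{q^*,Y^*}>0$ is a constant (depending only on $q$ and $Y$) with $\Delta_{\mathcal S^*}(x,y)\ge c_{q^*,Y^*}\|x-y\|^{q^*}$ for all $x,y\in Y^*$ (such constants exist by $r$-convexity of $Y$ and $q^*$-convexity of $Y^*$). *)

(* Defs.v *)
From HB Require Import structures.
From mathcomp Require Import all_boot all_order all_algebra.
From mathcomp Require Import interval_inference.
From mathcomp Require Import all_classical all_reals all_analysis.

Set Implicit Arguments.
Unset Strict Implicit.
Unset Printing Implicit Defensive.

Import Order.TTheory GRing.Theory Num.Theory.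
Import numFieldNormedType.Exports.

Local Open Scope classical_set_scope.
Local Open Scope ring_scope.

(* [dual X] is the space X^* of continuous linear functionals, equipped with
   the operator norm. It is again a normed module, so that everything below
   also applies to functionals on X^* ; their subgradients live in X^**. *)
Section Dual.
Context {R : realType} (X : normedModType R).

Definition dual_pred : {pred X -> R^o} :=
  [pred p | `[< linear p /\ continuous p >]].

Record dual := Dual { dual_fun :> X -> R^o ; _ : dual_fun \in dual_pred }.

HB.instance Definition _ := [isSub for dual_fun].
HB.instance Definition _ := [Choice of dual by <:].

Lemma dual_predP (p : X -> R^o) :
  p \in dual_pred <-> linear p /\ continuous p.
Proof. by split=> [/asboolP|lp] //; exact/asboolP. Qed.

Lemma dual_pred_submod : submod_closed dual_pred.
Proof.
split=> [|a p p' /dual_predP[lp cp] /dual_predP[lp' cp']]; apply/dual_predP.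
  by split=> [b u v|x]; [rewrite /= scaler0 addr0|exact: cst_continuous].
split=> [b u v|x].
  rewrite !fctE lp lp' !scalerDr !scalerA mulrC -!addrA; congr (_ + _).
  by rewrite addrCA.
by apply: cvgD; [apply: cvgZl_tmp; exact: cp|exact: cp'].
Qed.

HB.instance Definition _ :=
  GRing.isSubmodClosed.Build _ _ dual_pred dual_pred_submod.
HB.instance Definition _ := [SubChoice_isSubLmodule of dual by <:].

Lemma dual_linear (p : dual) : linear p.
Proof. by have /dual_predP[] := valP p. Qed.

Lemma dual_continuous (p : dual) : continuous p.
Proof. by have /dual_predP[] := valP p. Qed.

HB.instance Definition _ (p : dual) :=
  GRing.isLinear.Build R X R^o _ (dual_fun p) (dual_linear p).

Definition dual_norm (p : dual) : R :=
  sup [set `|p x| | x in [set x : X | `|x| <= 1]].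

Lemma dual_norm_has_sup (p : dual) :
  has_sup [set `|p x| | x in [set x : X | `|x| <= 1]].
Proof.
split; first by exists `|p 0|, 0 => //=; rewrite normr0.
have /linear_bounded_continuous/bounded_funP/(_ 1)[M pM] :
  continuous (p : {linear X -> R^o}) by exact: dual_continuous.
by exists M => _ [x /= x1 <-]; exact: pM.
Qed.

Lemma dual_norm_ge0 (p : dual) : 0 <= dual_norm p.
Proof.
apply: le_trans (ub_le_sup (dual_norm_has_sup p).2 _); last first.
  by exists 0; [rewrite /= normr0|].
exact: normr_ge0.
Qed.

Lemma dual_norm_le (p : dual) x : `|p x| <= dual_norm p * `|x|.
Proof.
have [->|x0] := eqVneq x 0; first by rewrite linear0 !normr0 mulr0.
rewrite -ler_pdivrMr ?normr_gt0//.
apply: (ub_le_sup (dual_norm_has_sup p).2); exists (`|x|^-1 *: x) => /=.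
  by rewrite normrZ normfV normr_id mulVf// normr_eq0.
by rewrite linearZ/= normrZ normfV normr_id mulrC.
Qed.

Lemma dual_norm_ub (p : dual) M :
  (forall x, `|x| <= 1 -> `|p x| <= M) -> dual_norm p <= M.
Proof.
move=> pM; apply: ge_sup; first exact: (dual_norm_has_sup p).1.
by move=> _ [x /= x1 <-]; exact: pM.
Qed.

Lemma dual_normD (p p' : dual) : dual_norm (p + p') <= dual_norm p + dual_norm p'.
Proof.
apply: dual_norm_ub => x x1; apply: le_trans (ler_normD (p x) (p' x)) _.
by apply: lerD; [apply: le_trans (dual_norm_le p x) _|
                 apply: le_trans (dual_norm_le p' x) _];
  rewrite ler_piMr ?dual_norm_ge0.
Qed.

Lemma dual_normZ_le (a : R) (p : dual) :
  dual_norm (a *: p) <= `|a| * dual_norm p.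
Proof.
apply: dual_norm_ub => x x1; rewrite [leLHS](normrM a (p x)).
apply: ler_wpM2l => //; apply: le_trans (dual_norm_le p x) _.
by rewrite ler_piMr ?dual_norm_ge0.
Qed.

Lemma dual_normZ (a : R) (p : dual) : dual_norm (a *: p) = `|a| * dual_norm p.
Proof.
apply/eqP; rewrite eq_le dual_normZ_le/=.
have [->|a0] := eqVneq a 0; first by rewrite normr0 mul0r dual_norm_ge0.
rewrite -ler_pdivlMl ?normr_gt0// -normfV.
by rewrite -{1}(scale1r p) -(mulVf a0) -scalerA dual_normZ_le.
Qed.

Lemma dual_norm_eq0 (p : dual) : dual_norm p = 0 -> p = 0.
Proof.
move=> p0; apply/val_inj/funext => x; apply/eqP.
by rewrite -normr_le0 (le_trans (dual_norm_le p x))// p0 mul0r.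
Qed.

HB.instance Definition _ :=
  Lmodule_isNormed.Build R dual dual_normD dual_normZ dual_norm_eq0.

End Dual.

Section AdjointEvaluation.
Context {R : realType}.

Lemma adjoint_subproof (X Y : normedModType R) (T : {linear X -> Y})
    (cT : continuous T) (p : dual Y) : (p \o T : X -> R^o) \in @dual_pred R X.
Proof.
apply/dual_predP; split=> [a u v|x]; first by rewrite /= !linearP.
by apply: continuous_comp; [exact: cT|exact: dual_continuous].
Qed.

Definition adjoint (X Y : normedModType R) (T : {linear X -> Y})
  (cT : continuous T) (p : dual Y) : dual X := Dual (adjoint_subproof cT p).

Lemma evaluation_subproof (Y : normedModType R) (y : Y) :
  (fun p : dual Y => p y : R^o) \in @dual_pred R (dual Y).
Proof.
pose ev0 : dual Y -> R^o := fun p => p y.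
apply/dual_predP; have le_ev : linear ev0 by [].
change (linear ev0 /\ continuous ev0).
split => //; pose L := GRing.isLinear.Build R (dual Y) R^o _ _ le_ev.
pose ev : {linear dual Y -> R^o} := HB.pack ev0 L.
apply: (@bounded_linear_continuous _ _ _ ev); apply/bounded_funP => M.
exists (M * `|y|) => p pM; apply: le_trans (dual_norm_le p y) _.
by rewrite ler_wpM2r.
Qed.

(* The canonical embedding of Y into its bidual. *)
Definition evaluation (Y : normedModType R) (y : Y) : dual (dual Y) :=
  Dual (evaluation_subproof y).

End AdjointEvaluation.

Section ConvexAnalysis.
Context {R : realType} {X : normedModType R}.
Implicit Types (F : X -> \bar R) (x : X) (xs : dual X).
Local Open Scope ereal_scope.

Definition proper_fun F :=
  (forall x, -oo < F x) /\ (exists x, F x < +oo).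

(* [convex_function] of the library only covers real-valued functions. *)
Definition econvex_function F := forall x0 x (t : R), (0 <= t <= 1)%R ->
  F (t *: x0 + (1 - t) *: x)%R <= t%:E * F x0 + (1 - t)%:E * F x.

Definition subdiff F x0 : set (dual X) :=
  [set xs | F x0 \is a fin_num /\
            forall x, F x0 + (xs (x - x0)%R)%:E <= F x].

(* [bregman F xs x x0] is the Bregman distance of x and x0 with respect to F
   and the subgradient xs at x0. *)
Definition bregman F xs x x0 : \bar R := F x - F x0 - (xs (x - x0)%R)%:E.

Definition fenchel F xs : \bar R := ereal_sup (range (fun x => (xs x)%:E - F x)).

Definition minimizer F x := forall x', F x <= F x'.

End ConvexAnalysis.

Section Geometry.
Context {R : realType} (Y : normedModType R).

(* Extended real valued, so that no convention is hidden in suprema and infima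
   over possibly empty sets. *)
Definition convexity_modulus (eps : R) : \bar R :=
  ereal_inf [set (1 - `|u.1 + u.2| / 2)%:E | u in
    [set u : Y * Y | [/\ `|u.1| = 1, `|u.2| = 1 & `|u.1 - u.2| = eps]]].

Definition smoothness_modulus (tau : R) : \bar R :=
  ereal_sup [set ((`|u.1 + u.2| + `|u.1 - u.2|) / 2 - 1)%:E | u in
    [set u : Y * Y | `|u.1| = 1 /\ `|u.2| = tau]].

Definition smooth_and_convex (q r : R) := exists K : R, [/\ 0 < K,
  forall tau, 0 < tau -> (smoothness_modulus tau <= (K * tau `^ q)%:E)%E &
  forall eps, 0 < eps <= 2 ->
    ((K^-1 * eps `^ r)%:E <= convexity_modulus eps)%E].

Definition norm_power (q : R) (g : Y) : \bar R := (q^-1 * `|g| `^ q)%:E.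

End Geometry.

Section IndexFunctions.
Context {R : realType}.
Implicit Types Phi : R -> R.

(* Only the restriction of Phi to [0, +oo) matters; monotonicity is not
   required to be strict. *)
Definition index_function Phi := [/\ Phi 0 = 0,
  forall s, 0 <= s -> 0 <= Phi s,
  {within [set s : R | 0 <= s], continuous Phi} &
  forall s t, 0 <= s -> s <= t -> Phi s <= Phi t].

(* The conjugate of the convex-analytic function equal to -Phi on [0, +oo) and
   to +oo elsewhere. *)
Definition neg_conjugate Phi (x : R) : \bar R :=
  ereal_sup [set (x * tau + Phi tau)%:E | tau in [set tau : R | 0 <= tau]].

End IndexFunctions.

Section Regularization.
Context {R : realType} {X Y : normedModType R}.
Variables (T : {linear X -> Y}) (cT : continuous T).
Variables (S : Y -> \bar R) (Reg : X -> \bar R).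
Local Open Scope ereal_scope.

(* The penalty [Pen] is Reg in the first step of Bregman iteration and a Bregman
   distance of Reg in the second one. *)
Definition tikhonov (alpha : R) (gobs : Y) (Pen : X -> \bar R) (f : X) : \bar R :=
  (alpha^-1)%:E * S (T f - gobs)%R + Pen f.

Definition dual_tikhonov (alpha : R) (gobs : Y) (p : dual Y) : \bar R :=
  (alpha^-1)%:E * fenchel S (- alpha *: p)%R - (p gobs)%:E
    + fenchel Reg (adjoint cT p).

Definition VSC3 (q : R) (fd : X) (Phi : R -> R)
    (p : dual Y) (w : X) (beta mu tbar : R) : Prop :=
  [/\ [/\ (0 <= beta)%R, (1 < mu)%R & (0 < tbar)%R],
      subdiff Reg fd (adjoint cT p),
      subdiff (fenchel S) p (evaluation (T w)) &
      exists fs : R -> dual X, forall t : R, (0 < t <= tbar)%R ->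
        subdiff Reg (fd - t *: w)%R (fs t) /\
        forall f : X,
          ((fs t - adjoint cT p)%R (fd - t *: w - f)%R)%:E <=
          bregman Reg (fs t) f (fd - t *: w)%R
          + (t ^+ 2 * Phi (t `^ (- q) * `|T f - T fd + t *: T w| `^ q)
             + beta * t `^ (2 * mu))%:E].

End Regularization.

(* Main.v *)
From HB Require Import structures.
Require Import Defs.
From mathcomp Require Import all_boot all_order all_algebra.
From mathcomp Require Import all_classical all_reals all_analysis.
From mathcomp Require Import ring lra.

(** Write [t = alpha^(q^* - 1)], so that [alpha = t^(q-1)], [S] for the [q]-th
    power functional and [pbar], [w] for the source elements. By homogeneity
    [- alpha pbar] is a subgradient of [S] at [- t Tw].

    Since [Y] is smooth, [S] is Gateaux differentiable, so the minimality of
    [f1] provides a dual solution without duality gap. In the resulting identity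
    between the primal and the dual functional, the convexity of [S] at
    [- t Tw] and of [S^*] at [- alpha pbar] leaves
    [c_q/alpha max(t|Tw|, d)^(q-r) d^r + c_qs t |p1 - pbar|^qs]
    with [d = |Tf1 - gobs + t Tw|] on one side and
    [R(f_t) - R(f1) - <pbar, Tf_t - Tf1> + <p1 - pbar, gobs - Tfd>] with
    [f_t = fd - t w] on the other. In VSC^3 at [f = f1] the subgradient [f_t^*]
    cancels, and what remains bounds precisely this quantity. An a priori bound
    [d <= C t (c + |Tw|)] makes the first term an [r]-th power of [d], which
    is absorbed into the conjugate of [- Phi~].

    This bounds [t |p1 - pbar|^qs]; comparing the second Tikhonov functional at
    [f2] and at [fd] and using Young's inequality then bounds the error of
    [f2]. *)

Set Implicit Arguments.
Unset Strict Implicit.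
Unset Printing Implicit Defensive.

Import Order.TTheory GRing.Theory Num.Theory.
Import numFieldNormedType.Exports.

Local Open Scope classical_set_scope.
Local Open Scope ring_scope.

(** * Powers of nonnegative reals *)

Section RealPowers.
Context {R : realType}.
Implicit Types q qs s u v C eps : R.

Lemma conjugate_exponent q qs : 1 < q -> q^-1 + qs^-1 = 1 ->
  1 < qs /\ (q - 1) * (qs - 1) = 1.
Proof.
move=> q1 qqs.
have qV1 : q^-1 < 1 by rewrite invf_lt1; lra.
have qV0 : 0 < q^-1 by rewrite invr_gt0; lra.
have qs0 : 0 < qs by rewrite -invr_gt0; lra.
have e : qs = q * (qs - 1).
  have : q * qs * (q^-1 + qs^-1) = q * qs by rewrite qqs mulr1.
  by rewrite mulrDr mulrAC !mulfK ?mulfV ?gt_eqF//; lra.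
split; last by lra.
rewrite -(invrK qs) invf_gt1 ?invr_gt0//; lra.
Qed.

Lemma powR_conjugate q qs v : 1 < q -> q^-1 + qs^-1 = 1 ->
  (v `^ (q - 1)) `^ qs = v `^ q.
Proof.
move=> q1 qqs; rewrite -powRrM; congr (_ `^ _).
by have [_] := conjugate_exponent q1 qqs; lra.
Qed.

(** Young's inequality for [u] and [v^(q-1)], since the conjugate power of [v^(q-1)] is [v^q]. *)
Lemma powR_tangent q u v : 1 < q -> 0 <= u -> 0 <= v ->
  q^-1 * v `^ q + v `^ (q - 1) * (u - v) <= q^-1 * u `^ q.
Proof.
move=> q1 u0 v0; set qs := (1 - q^-1)^-1.
have q0 : q != 0 by lra.
have qV1 : q^-1 < 1 by rewrite invf_lt1; lra.
have qqs : q^-1 + qs^-1 = 1 by rewrite invrK; lra.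
have qs0 : 0 < qs by rewrite invr_gt0; lra.
have := @conjugate_powR R u (v `^ (q - 1)) q qs u0 (powR_ge0 _ _).
have qp : 0 < q by lra.
move=> /(_ qp qs0 qqs); rewrite (powR_conjugate _ q1 qqs).
rewrite mulrBr (mulrC _ v) mulr_powRB1//.
have -> : qs^-1 = 1 - q^-1 by lra.
by rewrite !(mulrC _^-1) (mulrC u); lra.
Qed.

Lemma powR_small (e C eps : R) : 0 < e -> 0 <= C -> 0 < eps ->
  exists2 s0, 0 < s0 & forall s, 0 < s -> s <= s0 -> C * s `^ e <= eps.
Proof.
move=> e0 C0 eps0; exists ((eps / (C + 1)) `^ e^-1).
  by rewrite powR_gt0// divr_gt0//; lra.
move=> s s0 ss; have C1 : 0 < C + 1 by lra.
have : s `^ e <= eps / (C + 1).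
  have := ge0_ler_powR (ltW e0) (ltW s0) (powR_ge0 _ _) ss.
  by rewrite -powRrM mulVf ?gt_eqF// powRr1// ltW// divr_gt0.
rewrite ler_pdivlMr// => se; apply: le_trans se.
by rewrite mulrC ler_wpM2l ?powR_ge0//; lra.
Qed.

(** The tangent at the moved point [v + s a] bounds the increment by [s a (v + s a)^(q-1)], and
    continuity of the power replaces the slope by the one at [v]. *)
Lemma powR_derivative_upper (q v a eps : R) : 1 < q -> 0 < v -> 0 < eps ->
  exists2 s0, 0 < s0 & forall s, 0 < s -> s <= s0 -> 0 <= v + s * a ->
    q^-1 * (v + s * a) `^ q <= q^-1 * v `^ q + s * (v `^ (q - 1) * a + eps).
Proof.
move=> q1 v0 eps0.
have : a * (v + s * a) `^ (q - 1) @[s --> (0:R)] --> a * (v + 0 * a) `^ (q - 1).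
  apply: cvgM; first exact: cvg_cst.
  have cp : x `^ (q - 1) @[x --> v + 0 * a] --> (v + 0 * a) `^ (q - 1).
    apply: (@differentiable_continuous R R^o R^o (v + 0 * a)
      (fun x => x `^ (q - 1))); apply/derivable1_diffP.
    by apply: derivable_powR; rewrite mul0r addr0 in_itv/= v0.
  apply: cvg_comp cp; apply: cvgD; first exact: cvg_cst.
  by apply: cvgM; [exact: cvg_id|exact: cvg_cst].
rewrite mul0r addr0 => /cvgrPdist_le/(_ _ eps0)/nbhs_ballP[d /= d0 dP].
exists (d / 2); first by rewrite divr_gt0.
move=> s s0 sd va0.
have /dP : ball (0:R) d s by rewrite /ball/= sub0r normrN gtr0_norm//; lra.
rewrite distrC => /(le_trans (ler_norm _)) H.
have := @powR_tangent q v (v + s * a) q1 (ltW v0) va0.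
suff : (v + s * a) `^ (q - 1) * (s * a) <= s * (v `^ (q - 1) * a + eps) by lra.
by rewrite mulrCA ler_pM2l//; lra.
Qed.

End RealPowers.

(** * One-sided directional derivatives of the norm *)

Section NormDerivative.
Context {R : realType} {Y : normedModType R}.
Implicit Types (z h : Y) (s : R).

Definition norm_quotient z h s : R := (`|z + s *: h| - `|z|) / s.

(** The quotient is nondecreasing in [s], so this infimum is the right-hand derivative of the norm
    at [z] in direction [h]. *)
Definition norm_derivative z h : R :=
  inf [set norm_quotient z h s | s in [set s : R | 0 < s]].

Lemma norm_quotient_ge z h s : 0 < s -> - `|h| <= norm_quotient z h s.
Proof.
move=> s0; rewrite ler_pdivlMr// mulNr lerBrDr addrC lerBlDr.
have -> : `|h| * s = `| - (s *: h)| by rewrite normrN normrZ gtr0_norm// mulrC.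
by apply: le_trans (ler_normD _ _); rewrite addrK.
Qed.

Lemma norm_quotient_le z h s : 0 < s -> norm_quotient z h s <= `|h|.
Proof.
move=> s0; rewrite ler_pdivrMr// lerBlDl.
have -> : `|h| * s = `|s *: h| by rewrite normrZ gtr0_norm// mulrC.
exact: ler_normD.
Qed.

(** Convexity of the norm, through [s' (z + s h) = (s' - s) z + s (z + s' h)]. *)
Lemma norm_quotient_mono z h s s' : 0 < s -> s <= s' ->
  norm_quotient z h s <= norm_quotient z h s'.
Proof.
move=> s0 ss'; have s'0 := lt_le_trans s0 ss'.
rewrite ler_pdivrMr// mulrAC ler_pdivlMr//.
have : `|s' *: (z + s *: h)| <= `|(s' - s) *: z| + `|s *: (z + s' *: h)|.
  apply: le_trans (ler_normD _ _); rewrite le_eqVlt; apply/orP; left; apply/eqP.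
  congr `| _ |; rewrite !scalerDr !scalerA scalerBl (mulrC s') addrA.
  by rewrite subrK.
by rewrite !normrZ (gtr0_norm s0) (gtr0_norm s'0) ger0_norm ?subr_ge0//; lra.
Qed.

Lemma norm_quotient_has_inf z h :
  has_inf [set norm_quotient z h s | s in [set s : R | 0 < s]].
Proof.
split; first by exists (norm_quotient z h 1), 1 => /=.
by exists (- `|h|) => _ [s /= s0 <-]; exact: norm_quotient_ge.
Qed.

Lemma norm_derivative_le_quotient z h s :
  0 < s -> norm_derivative z h <= norm_quotient z h s.
Proof.
by move=> s0; apply: ge_inf; [exact: (norm_quotient_has_inf z h).2|exists s].
Qed.

Lemma norm_derivative_ge z h M :
  (forall s, 0 < s -> M <= norm_quotient z h s) -> M <= norm_derivative z h.
Proof.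
move=> H; apply: lb_le_inf; first exact: (norm_quotient_has_inf z h).1.
by move=> _ [s /= s0 <-]; exact: H.
Qed.

Lemma norm_derivative_adherent z h eps : 0 < eps ->
  exists2 s0, 0 < s0 & forall s, 0 < s -> s <= s0 ->
    norm_quotient z h s <= norm_derivative z h + eps.
Proof.
move=> eps0; have [_ [s0 /= s00 <-] H] :=
  inf_adherent eps0 (norm_quotient_has_inf z h).
exists s0 => // s sp ss0.
exact: le_trans (norm_quotient_mono _ _ sp ss0) (ltW H).
Qed.

(** The point [z + (s/2) (h + h')] is the midpoint of [z + s h] and [z + s h']. *)
Lemma norm_derivativeD_le z h h' :
  norm_derivative z (h + h') <= norm_derivative z h + norm_derivative z h'.
Proof.
apply/ler_addgt0Pr => eps eps0; have e2 : 0 < eps / 2 by rewrite divr_gt0.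
have [s0 s00 H] := norm_derivative_adherent z h e2.
have [s1 s10 H'] := norm_derivative_adherent z h' e2.
pose s := Num.min s0 s1; have sp : 0 < s by rewrite lt_min s00.
have /(H _ sp) hs : s <= s0 by rewrite ge_min lexx.
have /(H' _ sp) hs' : s <= s1 by rewrite ge_min lexx orbT.
have s2 : 0 < s / 2 by rewrite divr_gt0.
have := norm_derivative_le_quotient z (h + h') s2.
suff : norm_quotient z (h + h') (s / 2) <=
    norm_quotient z h s + norm_quotient z h' s by lra.
rewrite /norm_quotient -mulrDl ler_pdivrMr// mulrA divfK ?gt_eqF//.
have : `|2 *: (z + (s / 2) *: (h + h'))| <= `|z + s *: h| + `|z + s *: h'|.
  apply: le_trans (ler_normD _ _); rewrite le_eqVlt; apply/orP; left; apply/eqP.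
  congr `| _ |; rewrite scalerDr scalerA mulrCA mulfV ?mulr1// scalerDr.
  by rewrite scaler_nat mulr2n addrACA.
by rewrite normrZ gtr0_norm//; lra.
Qed.

Lemma norm_derivativeZ_gt0 z h a : 0 < a ->
  norm_derivative z (a *: h) = a * norm_derivative z h.
Proof.
(* This inequality suffices: applied to [a^-1] and [a *: h] it gives the converse one. *)
have H b k : 0 < b -> b * norm_derivative z k <= norm_derivative z (b *: k).
  move=> b0; apply: norm_derivative_ge => s s0.
  rewrite mulrC -ler_pdivlMr//.
  apply: le_trans (norm_derivative_le_quotient z k (mulr_gt0 s0 b0)) _.
  by rewrite /norm_quotient scalerA invfM -!mulrA.
move=> a0; apply/eqP; rewrite eq_le H// andbT -ler_pdivrMl// .
have /H/le_trans := a0.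
have := @H a^-1 (a *: h); rewrite invr_gt0 scalerA mulVf ?gt_eqF// scale1r.
by move=> /(_ a0) + _.
Qed.

Lemma norm_derivative_bound z h : `|norm_derivative z h| <= `|h|.
Proof.
rewrite ler_norml; apply/andP; split.
  by apply: norm_derivative_ge => s; exact: norm_quotient_ge.
exact: le_trans (norm_derivative_le_quotient _ _ ltr01)
  (norm_quotient_le _ _ ltr01).
Qed.

Lemma norm_derivative0 z : norm_derivative z 0 = 0.
Proof.
by apply/eqP; rewrite -normr_le0 (le_trans (norm_derivative_bound _ _))// normr0.
Qed.

(** After division by [|z|] the points [z + s h] and [z - s h] are admissible in the smoothness
    modulus at [s |h| / |z|]. The sum of the two quotients is therefore at most [C s^(q-1)], which
    tends to 0. *)
Lemma norm_derivativeN_le0 (q r : R) z h : 1 < q -> smooth_and_convex Y q r ->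
  z != 0 -> norm_derivative z h + norm_derivative z (- h) <= 0.
Proof.
move=> q1 [K [K0 Hs _]] z0; have [->|h0] := eqVneq h 0.
  by rewrite oppr0 norm_derivative0 addr0.
have nz : 0 < `|z| by rewrite normr_gt0.
have nh : 0 < `|h| by rewrite normr_gt0.
apply/ler_addgt0Pl => eps eps0; rewrite addr0.
pose C := 2 * `|z| * K * (`|h| / `|z|) `^ q.
have C0 : 0 <= C.
  by rewrite /C !mulr_ge0 ?powR_ge0 ?invr_ge0// ?mulr_ge0// ltW.
have q10 : 0 < q - 1 by lra.
have [s s0 /(_ s s0 (lexx _)) Cs] := powR_small q10 C0 eps0.
have t0 : 0 < s * (`|h| / `|z|) by rewrite mulr_gt0// divr_gt0.
have := Hs _ t0.
have : (((`| `|z|^-1 *: (z + s *: h)| + `| `|z|^-1 *: (z - s *: h)|) / 2 - 1)%:E <=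
   smoothness_modulus Y (s * (`|h| / `|z|)))%E.
  apply: ereal_sup_ubound; exists (`|z|^-1 *: z, `|z|^-1 *: (s *: h)).
    rewrite /= !normrZ normfV normr_id mulVf ?gt_eqF//; split => //.
    by rewrite gtr0_norm// mulrCA (mulrC _^-1).
  by rewrite /= !scalerDr scalerN.
move=> /le_trans /[apply]; rewrite lee_fin !normrZ normfV normr_id -mulrDr.
rewrite (powRM _ (ltW s0)) ?divr_ge0// => H.
have := norm_derivative_le_quotient z h s0.
have := norm_derivative_le_quotient z (- h) s0.
suff : norm_quotient z h s + norm_quotient z (- h) s <= eps by lra.
rewrite /norm_quotient scalerN -mulrDl ler_pdivrMr//.
apply: le_trans (_ : C * s `^ (q - 1) * s <= _); last by rewrite ler_pM2r.
have {H} : `|z| * (`|z|^-1 * (`|z + s *: h| + `|z - s *: h|)) <=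
  `|z| * (2 * (1 + K * (s `^ q * (`|h| / `|z|) `^ q))).
  by rewrite ler_pM2l//; lra.
rewrite mulVKf ?gt_eqF// -mulrA (mulrC (s `^ (q - 1))).
by rewrite mulr_powRB1 ?(ltW s0)// /C; lra.
Qed.

(* Smoothness makes the one-sided derivative of the norm odd; being sublinear,
   it is then linear, which yields the supporting functional of z without the
   Hahn-Banach theorem. *)
Lemma norm_derivative_linear (q r : R) z : 1 < q -> smooth_and_convex Y q r ->
  z != 0 -> linear (norm_derivative z : Y -> R^o).
Proof.
move=> q1 sm z0.
have DN h : norm_derivative z (- h) = - norm_derivative z h.
  have := norm_derivativeN_le0 h q1 sm z0.
  have := norm_derivativeD_le z h (- h); rewrite subrr norm_derivative0.
  lra.
have DD h h' : norm_derivative z (h + h') =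
    norm_derivative z h + norm_derivative z h'.
  apply/eqP; rewrite eq_le norm_derivativeD_le/=.
  by have := norm_derivativeD_le z (- h) (- h'); rewrite -opprD !DN; lra.
move=> a u v; rewrite DD; congr (_ + _).
have [a0|a0|->] := ltrgtP a 0.
- have Na : 0 < - a by lra.
  have := norm_derivativeZ_gt0 z u Na.
  by rewrite scaleNr DN mulNr => /oppr_inj.
- exact: norm_derivativeZ_gt0.
- by rewrite !scale0r norm_derivative0.
Qed.

(** The functional is the one-sided derivative itself. Comparison with the quotient at [s = 1] makes
    it a subgradient; near-attainment of the infimum gives the upper bound. *)
Lemma norm_gateaux (q r : R) z : 1 < q -> smooth_and_convex Y q r -> z != 0 ->
  exists l : dual Y, [/\ forall y, `|z| + l (y - z) <= `|y| &
    forall h eps, 0 < eps -> exists2 s0, 0 < s0 & forall s, 0 < s -> s <= s0 ->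
      `|z + s *: h| <= `|z| + s * (l h + eps)].
Proof.
move=> q1 sm z0; have lin := norm_derivative_linear q1 sm z0.
have ld : (norm_derivative z : Y -> R^o) \in @dual_pred R Y.
  apply/dual_predP; split => //.
  pose L := GRing.isLinear.Build R Y R^o _ _ lin.
  pose l : {linear Y -> R^o} := HB.pack (norm_derivative z : Y -> R^o) L.
  apply: (@bounded_linear_continuous _ _ _ l); apply/bounded_funP => M.
  by exists M => h; apply: le_trans; exact: norm_derivative_bound.
exists (Dual ld); split => [y|h eps eps0] /=.
  have := norm_derivative_le_quotient z (y - z) ltr01.
  by rewrite /norm_quotient scale1r divr1 (addrC z) subrK; lra.
have [s0 s00 H] := norm_derivative_adherent z h eps0.
exists s0 => // s sp ss; have := H s sp ss.
by rewrite ler_pdivrMr// ; lra.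
Qed.

End NormDerivative.

(** * Fenchel conjugates and subgradients *)

Section Conjugates.
Context {R : realType} {X : normedModType R}.
Implicit Types (F : X -> \bar R) (x : X) (xs : dual X).

Lemma fenchel_ge F xs x : ((xs x)%:E - F x <= fenchel F xs)%E.
Proof. by apply: ereal_sup_ubound; exists x. Qed.

Lemma fenchel_subdiff F x xs : subdiff F x xs ->
  fenchel F xs = ((xs x)%:E - F x)%E.
Proof.
move=> [Fx H]; apply/eqP; rewrite eq_le fenchel_ge andbT.
apply: ge_ereal_sup => _ [x' _ <-]; have := H x'.
rewrite -(fineK Fx) linearB/=.
case: (F x') => [a||] //; last by rewrite addeNy leNye.
by rewrite -!EFinB -!EFinD !lee_fin; lra.
Qed.

(** Young's inequality for [x] and [xs'] is subtracted from the equality for [x] and [xs]. *)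
Lemma subdiff_fenchel F x xs : subdiff F x xs ->
  subdiff (fenchel F) xs (evaluation x).
Proof.
move=> sF; have [Fx _] := sF.
rewrite /subdiff/= (fenchel_subdiff sF) -(fineK Fx).
split=> // xs'; apply: le_trans (fenchel_ge F xs' x).
rewrite -(fineK Fx) -!EFinB -EFinD lee_fin.
rewrite [X in _ + X](_ : _ = xs' x - xs x)//.
lra.
Qed.

End Conjugates.

(** * Differentiability of the power functional and first-order optimality *)

Section NormPower.
Context {R : realType} {Y : normedModType R} (q r : R).
Implicit Types (z : Y) (l : dual Y).

Lemma subdiff_norm_powerP z l : subdiff (norm_power q) z l <->
  forall y, q^-1 * `|z| `^ q + l (y - z) <= q^-1 * `|y| `^ q.
Proof.
split=> [[_ H] y|H]; first by have := H y; rewrite /norm_power -EFinD lee_fin.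
by split=> // y; rewrite /norm_power -EFinD lee_fin.
Qed.

(** Chain rule: the derivative is [|z|^(q-1)] times that of the norm, and 0 at [z = 0] because
    [q > 1]. The bound [s <= 1] allows [s] to serve as a convex weight later. *)
Lemma norm_power_gateaux z : 1 < q -> smooth_and_convex Y q r ->
  exists l : dual Y, subdiff (norm_power q) z l /\
    forall h eps, 0 < eps -> exists s, [/\ 0 < s, s <= 1 &
      q^-1 * `|z + s *: h| `^ q <= q^-1 * `|z| `^ q + s * (l h + eps)].
Proof.
move=> q1 sm; have q0 : 0 < q^-1 by rewrite invr_gt0; lra.
have q10 : 0 < q - 1 by lra.
have qN0 : q != 0 by rewrite gt_eqF//; lra.
have [->|z0] := eqVneq z 0.
  exists 0; split.
    apply/subdiff_norm_powerP => y.
    rewrite normr0 powR0// mulr0 add0r.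
    by rewrite [leLHS](_ : _ = 0)// mulr_ge0 ?powR_ge0// ltW.
  move=> h eps eps0.
  have C0 : 0 <= q^-1 * `|h| `^ q by rewrite mulr_ge0 ?powR_ge0// ltW.
  have [s0 s00 H] := powR_small q10 C0 eps0.
  have s1 : 0 < Num.min s0 1 by rewrite lt_min s00 ltr01.
  exists (Num.min s0 1); split => //; first by rewrite ge_min lexx orbT.
  have {H} := H _ s1; rewrite ge_min lexx => /(_ erefl).
  move: s1; set s := Num.min _ _ => s1 H.
  rewrite normr0 add0r normrZ gtr0_norm// powRM ?(ltW s1)//.
  rewrite powR0// mulr0 add0r -(mulr_powRB1 (ltW s1))//; last lra.
  have -> : (0 : dual Y) h = 0 by [].
  by rewrite -mulrA mulrCA ler_pM2l//; lra.
have [g [gl gu]] := norm_gateaux q1 sm z0.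
have nz : 0 < `|z| by rewrite normr_gt0.
pose v := `|z| `^ (q - 1); have v0 : 0 < v by rewrite powR_gt0.
exists (v *: g); split.
  apply/subdiff_norm_powerP => y.
  apply: le_trans (powR_tangent q1 (normr_ge0 y) (normr_ge0 z)).
  rewrite lerD2l.
  have -> : (v *: g) (y - z) = v * g (y - z) by [].
  by rewrite ler_pM2l//; have := gl y; lra.
move=> h eps eps0.
(* Half of [eps] is spent on the power; the other half, divided by the slope [v], on the norm. *)
have e2 : 0 < eps / 2 by rewrite divr_gt0.
have ev : 0 < eps / 2 / v by rewrite divr_gt0.
have [s0 s00 H0] := gu h _ ev.
have [s1 s10 H1] := powR_derivative_upper (g h + eps / 2 / v) q1 nz e2.
pose s := Num.min s0 (Num.min s1 1).
have sp : 0 < s by rewrite !lt_min s00 s10 ltr01.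
have ss0 : s <= s0 by rewrite ge_min lexx.
have ss1 : s <= s1 by rewrite !ge_min lexx orbT.
have s1' : s <= 1 by rewrite !ge_min lexx !orbT.
exists s; split => //; have h0 := H0 s sp ss0.
have := H1 s sp ss1 (le_trans (normr_ge0 _) h0).
rewrite -/v (mulrDr v) [v * (_ / v)]mulrC divfK ?gt_eqF// => h1.
apply: le_trans (_ : q^-1 * (`|z| + s * (g h + eps / 2 / v)) `^ q <= _).
  rewrite ler_pM2l//; apply: ge0_ler_powR => //; rewrite ?nnegrE//.
    by lra.
  exact: le_trans (normr_ge0 _) h0.
apply: le_trans h1 _.
have -> : (v *: g) h = v * g h by [].
by lra.
Qed.

(* By norm_power_gateaux the functional S = norm_power q is the conjugate of its
   conjugate at y, so that equality in Young's inequality passes from S^* to S. *)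
Lemma subdiff_of_fenchel_norm_power (p : dual Y) (y : Y) :
  1 < q -> smooth_and_convex Y q r ->
  subdiff (fenchel (norm_power q)) p (evaluation y) ->
  subdiff (norm_power q) y p.
Proof.
move=> q1 sm [fp H]; have [l [sl _]] := norm_power_gateaux y q1 sm.
apply/subdiff_norm_powerP => y'.
have := H l.
rewrite [X in (_ + X%:E)%E](_ : _ = l y - p y)// (fenchel_subdiff sl).
have := fenchel_ge (norm_power q) p y'.
rewrite -(fineK fp) /norm_power -!EFinB -EFinD !lee_fin linearB/=.
lra.
Qed.

(** Homogeneity: the subgradient inequality at [y], tested with [- t^-1 y'], is multiplied by
    [t^q]. *)
Lemma subdiff_norm_powerZ (p : dual Y) (y : Y) t : 1 < q -> 0 < t ->
  subdiff (norm_power q) y p ->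
  subdiff (norm_power q) (- (t *: y)) (- (t `^ (q - 1)) *: p).
Proof.
move=> q1 t0 /subdiff_norm_powerP H; apply/subdiff_norm_powerP => y'.
have tq : 0 < t `^ q by rewrite powR_gt0.
have := H (- (t^-1 *: y')); rewrite -(ler_pM2l tq).
rewrite !normrN !normrZ normfV (gtr0_norm t0).
rewrite !powRM ?invr_ge0 ?(ltW t0)//.
have -> : t^-1 `^ q = (t `^ q)^-1.
  by rewrite -(powR_inv1 (ltW t0)) -powRrM mulN1r powRN.
rewrite (mulrCA (t `^ q) q^-1 (_^-1 * _)) mulVKf ?gt_eqF//.
have -> : (- t `^ (q - 1) *: p) (y' - - (t *: y)) =
    - t `^ (q - 1) * p (y' - - (t *: y)) by [].
have -> : y' - - (t *: y) = - (t *: (- (t^-1 *: y') - y)).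
  rewrite scalerBr scalerN scalerA mulfV ?gt_eqF// scale1r.
  by rewrite opprK opprB opprK addrC.
set y1 := - _ - y; have pt : p (- (t *: y1)) = - (t * p y1).
  by rewrite linearN linearZ.
rewrite pt.
have -> : t `^ q = t * t `^ (q - 1) by rewrite mulr_powRB1// ?ltW//; lra.
by lra.
Qed.

(** With [l] the derivative of the power functional at the residual, [f1] is compared with
    [s f + (1 - s) f1]. Convexity of [Reg] and the upper bound by [l] leave an inequality
    proportional to [s]; dividing by [s] shows that [- alpha^-1 l] composed with [T] is a
    subgradient of [Reg]. *)
Lemma tikhonov_optimality (X : normedModType R) (T : {linear X -> Y})
    (cT : continuous T) (Reg : X -> \bar R) alpha (g : Y) (f1 : X) :
  1 < q -> smooth_and_convex Y q r -> proper_fun Reg -> econvex_function Reg ->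
  0 < alpha -> minimizer (tikhonov T (norm_power q) alpha g Reg) f1 ->
  exists p : dual Y, subdiff Reg f1 (adjoint cT p) /\
    subdiff (norm_power q) (T f1 - g) (- alpha *: p).
Proof.
move=> q1 sm [RN [x0 Rx0]] cR a0 fm.
have [l [sl lu]] := norm_power_gateaux (T f1 - g) q1 sm.
have aV : 0 < alpha^-1 by rewrite invr_gt0.
have R1 : Reg f1 \is a fin_num.
  rewrite fin_numE gt_eqF//= lt_eqF//.
  have := fm x0; rewrite /tikhonov/norm_power.
  case: (Reg f1) => [a _| |] //; first exact: ltry.
  rewrite -!EFinM addey// leye_eq => /eqP.
  by move: Rx0 (RN x0); case: (Reg x0).
exists (- alpha^-1 *: l); rewrite scalerA mulrNN mulfV ?gt_eqF// scale1r.
split => //; split => // f.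
have := RN f; case Ef : (Reg f) => [rf| |]// _; last by rewrite leey.
have /fineK e1 := R1; rewrite -e1; set r1 := fine _ in e1 *.
have -> : (adjoint cT (- alpha^-1 *: l)) (f - f1) =
    - alpha^-1 * l (T (f - f1)) by [].
rewrite -EFinD lee_fin -lerBrDl.
apply/ler_addgt0Pr => eps eps0.
have ea : 0 < eps * alpha by rewrite mulr_gt0.
have [s [s0 s1 Hs]] := lu (T (f - f1)) _ ea.
have := fm (s *: f + (1 - s) *: f1).
have s01 : 0 <= s <= 1 by rewrite s1 ltW.
have := cR f f1 s s01.
rewrite /tikhonov/norm_power -e1 Ef -!EFinM -!EFinD.
have -> : T (s *: f + (1 - s) *: f1) - g = T f1 - g + s *: T (f - f1).
  rewrite linearD !linearZ/= scalerBl scale1r linearB scalerBr.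
  by rewrite addrCA addrAC.
move: (Reg _) => [b| |] //; rewrite ?leye_eq// -?EFinD !lee_fin// => Hb.
set n := `|_ + _| in Hs *; set u := `|T f1 - g| in Hs *.
rewrite -(ler_pM2l aV) in Hs.
move=> H; have : s * (r1 - rf) <=
    s * (alpha^-1 * (l (T (f - f1)) + eps * alpha)).
  rewrite mulrCA; lra.
rewrite ler_pM2l// mulrDr (mulrC eps) mulrA mulVf ?gt_eqF// mul1r.
lra.
Qed.

End NormPower.

(** * Scalar inequalities for absorbing error terms *)

Section RealEstimates.
Context {R : realType}.
Implicit Types q qs r t k : R.

(** Young's inequality for [u B] and [u^-1 d] with [u = lam t^(1/qs)]; here [q / qs = q - 1]. *)
Lemma young_scaled q qs (lam t B d : R) : 1 < q -> q^-1 + qs^-1 = 1 ->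
  0 < lam -> 0 < t -> 0 <= B -> 0 <= d ->
  B * d <= lam `^ qs / qs * (t * B `^ qs)
           + lam `^ (- q) / q * (d `^ q / t `^ (q - 1)).
Proof.
move=> q1 qqs l0 t0 B0 d0; have [qs1 qqs1] := conjugate_exponent q1 qqs.
have qs0 : 0 < qs by lra.
have q0 : 0 < q by lra.
pose u := lam * t `^ qs^-1.
have u0 : 0 < u by rewrite mulr_gt0 ?powR_gt0.
have uqs : u `^ qs = lam `^ qs * t.
  rewrite powRM ?powR_ge0 ?(ltW l0)// -powRrM mulVf ?gt_eqF//.
  by rewrite powRr1// ltW.
have uVq : u^-1 `^ q = lam `^ (- q) / t `^ (q - 1).
  rewrite -(powR_inv1 (ltW u0)) -powRrM mulN1r powRM ?powR_ge0 ?(ltW l0)//.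
  rewrite -powRrM -powRN; congr (_ * _ `^ _).
  have -> : qs^-1 = 1 - q^-1 by lra.
  by rewrite mulrBl mul1r mulrN mulVf ?gt_eqF//; lra.
clearbody u; have uu := ltW u0; have uV : 0 <= u^-1 by rewrite invr_ge0.
have := @conjugate_powR R (u * B) (u^-1 * d) qs q.
rewrite !mulr_ge0// => /(_ erefl erefl qs0 q0).
rewrite addrC => /(_ qqs).
rewrite mulrACA mulfV ?gt_eqF// mul1r powRM// (powRM _ _ d0)// uqs uVq.
by lra.
Qed.

Lemma young_small q qs k : 1 < q -> q^-1 + qs^-1 = 1 -> 0 < k ->
  exists2 C, 0 < C & forall t B d : R, 0 < t -> 0 <= B -> 0 <= d ->
    B * d <= k * (t * B `^ qs) + C * (d `^ q / t `^ (q - 1)).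
Proof.
move=> q1 qqs k0; have [qs1 _] := conjugate_exponent q1 qqs.
have kqs : 0 < k * qs by rewrite mulr_gt0//; lra.
pose lam := (k * qs) `^ qs^-1; have l0 : 0 < lam by rewrite powR_gt0.
exists (lam `^ (- q) / q); first by rewrite divr_gt0 ?powR_gt0//; lra.
move=> t B d t0 B0 d0; have := young_scaled q1 qqs l0 t0 B0 d0.
rewrite {1}/lam -powRrM mulVf ?powRr1 ?(ltW kqs) ?mulfK ?gt_eqF//; lra.
Qed.

(** Makes the residual bound explicit: [X] also occurs on the right, but with the factor [k k^(-q)],
    small for large [k]. *)
Lemma absorb_power q : 1 < q -> exists2 k, 1 <= k & forall X M : R,
  0 <= X -> 0 <= M -> X `^ q <= M `^ q + k * (M + k^-1 * (X + M)) `^ q ->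
  X <= k * M.
Proof.
move=> q1; have q10 : 0 < q - 1 by lra.
(* For k^(1-q) = c the right-hand side is at most X^q / 2 once M < X / k. *)
pose c : R := (2 * (3 `^ q + 1))^-1.
have c3 : 2 * (c * (3 `^ q + 1)) = 1.
  by rewrite mulrCA mulVf// gt_eqF// mulr_gt0// ltr_pwDr// powR_ge0.
have p3 : 0 < (3:R) `^ q by rewrite powR_gt0.
have c0 : 0 < c by rewrite invr_gt0; lra.
have c1 : c <= 1 by rewrite invf_le1; lra.
pose s := c `^ (q - 1)^-1.
have s0 : 0 < s by rewrite powR_gt0.
have s1 : s <= 1.
  apply: le_trans (_ : 1 `^ (q - 1)^-1 <= _); last by rewrite powR1.
  by apply: ge0_ler_powR; rewrite ?nnegrE ?invr_ge0// ltW.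
have sq : s `^ (q - 1) = c.
  by rewrite -powRrM mulVf ?gt_eqF// powRr1// ltW.
exists s^-1; first by rewrite invf_ge1.
move=> X M X0 M0; rewrite invrK => H; rewrite leNgt; apply/negP => MX.
have Xp : 0 < X by apply: le_lt_trans MX; rewrite mulr_ge0 ?invr_ge0// ltW.
have {}MX : M <= s * X by rewrite -ler_pdivrMl// ltW.
have s3 : 0 <= s * X by rewrite mulr_ge0// ltW.
have sM : s * M <= s * X by rewrite ler_pM2l// (le_trans MX)// ler_piMl.
have sM0 : 0 <= s * M by rewrite mulr_ge0// ltW.
have h1 : M `^ q <= (s * X) `^ q.
  by apply: ge0_ler_powR; rewrite ?nnegrE//; lra.
(* Each of [M], [s X] and [s M] is at most [s X]. *)
have h2 : (M + s * (X + M)) `^ q <= (3 * (s * X)) `^ q.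
  by apply: ge0_ler_powR; rewrite ?nnegrE; lra.
have h4 : (s * X) `^ q = s * c * X `^ q.
  rewrite powRM// ?(ltW s0)// -(mulr_powRB1 (ltW s0)) ?sq//; lra.
have Xq : 0 < X `^ q by rewrite powR_gt0.
have h5 : s^-1 * (M + s * (X + M)) `^ q <= 3 `^ q * c * X `^ q.
  rewrite ler_pdivrMl//; apply: le_trans h2 _.
  by rewrite powRM// h4; lra.
have h6 : s * c * X `^ q <= 1 * c * X `^ q by rewrite ler_pM2r// ler_pM2r.
have : (2 * (c * (3 `^ q + 1))) * X `^ q = X `^ q by rewrite c3 mul1r.
lra.
Qed.

(** Passes from the distance [d] to noisy data to the distance [A] to exact data, at the cost of the
    noise [e]. As [q - r <= 0], [mx <= k N] bounds [mx^(q-r)] from below, and [e <= N] gives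
    [N^(q-r) e^r <= e^q]. *)
Lemma power_tradeoff q r (cq k N mx d e A : R) : 1 < q -> q <= r ->
  0 < cq -> 0 < k -> 0 < N -> 0 <= d -> 0 <= e -> e <= N ->
  0 <= A -> A <= d + e -> d <= mx -> mx <= k * N ->
  cq * k `^ (q - r) / 2 `^ r * (N `^ (q - r) * A `^ r) <=
  cq * mx `^ (q - r) * d `^ r + cq * k `^ (q - r) * e `^ q.
Proof.
move=> q1 qr cq0 k0 N0 d0 e0 eN A0 Ade dmx mxkN.
have r0 : 0 <= r by lra.
have rN0 : r != 0 by rewrite gt_eqF//; lra.
have twor : 0 < (2:R) `^ r by rewrite powR_gt0.
have kp : 0 < k `^ (q - r) by rewrite powR_gt0.
have Np : 0 < N `^ (q - r) by rewrite powR_gt0.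
have Ar : A `^ r <= 2 `^ r * (d `^ r + e `^ r).
  have m0 : 0 <= Num.max d e by rewrite le_max d0.
  apply: le_trans (_ : (2 * Num.max d e) `^ r <= _).
    apply: ge0_ler_powR; rewrite ?nnegrE ?mulr_ge0//.
    have : d <= Num.max d e by rewrite le_max lexx.
    have : e <= Num.max d e by rewrite le_max lexx orbT.
    lra.
  rewrite powRM// ler_pM2l//; case: (leP d e) => _.
    by rewrite lerDr powR_ge0.
  by rewrite lerDl powR_ge0.
have antitone (x y : R) : 0 < x -> x <= y -> y `^ (q - r) <= x `^ (q - r).
  move=> x0 xy; have y0 := lt_le_trans x0 xy.
  rewrite -opprB !powRN lef_pV2 ?posrE ?powR_gt0//.
  by apply: ge0_ler_powR; rewrite ?nnegrE//; lra.
have hd : k `^ (q - r) * (N `^ (q - r) * d `^ r) <= mx `^ (q - r) * d `^ r.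
  (* For [d = 0] the base [mx] may vanish, where [antitone] does not apply. *)
  have [->|dN0] := eqVneq d 0; first by rewrite powR0// !mulr0.
  have dp : 0 < d by rewrite lt_neqAle eq_sym dN0.
  rewrite mulrA ler_pM2r ?powR_gt0// -powRM ?(ltW k0) ?(ltW N0)//.
  by apply: antitone => //; exact: lt_le_trans dmx.
have he : N `^ (q - r) * e `^ r <= e `^ q.
  have [->|eN0] := eqVneq e 0; first by rewrite powR0// mulr0 powR_ge0.
  have ep : 0 < e by rewrite lt_neqAle eq_sym eN0.
  apply: le_trans (_ : e `^ (q - r) * e `^ r <= _).
    by rewrite ler_pM2r ?powR_gt0// antitone.
  by rewrite -powRD ?subrK// eN0 implybT.
apply: le_trans
  (_ : cq * (k `^ (q - r) * (N `^ (q - r) * (d `^ r + e `^ r))) <= _).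
  rewrite -!mulrA ler_pM2l// ler_pM2l// mulrCA ler_pM2l// ler_pdivrMl//.
rewrite mulrDr mulrDr mulrDr -!mulrA; apply: lerD; rewrite ler_pM2l//.
by rewrite ler_pM2l.
Qed.

(** With [t^(q-1) = alpha] this exposes the factor [t^2] of the source condition and the argument
    [(A / t)^r] for the conjugate. *)
Lemma power_rescale q r (t a A : R) : 0 < t -> 0 <= a -> 0 <= A ->
  (t * a) `^ (q - r) * A `^ r / t `^ (q - 1)
  = t ^+ 2 * (a `^ (q - r) / t * (A / t) `^ r).
Proof.
move=> t0 a0 A0; have tN0 : t != 0 by rewrite gt_eqF.
have tp x : t `^ x != 0 by rewrite gt_eqF// powR_gt0.
have tV : t^-1 `^ r = (t `^ r)^-1.
  by rewrite -(powR_inv1 (ltW t0)) -powRrM mulN1r powRN.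
have tqr : t `^ (q - r) = t `^ q / t `^ r by rewrite powRB// tN0 implybT.
have tq1 : t `^ (q - 1) = t `^ q / t.
  by rewrite powRB ?tN0 ?implybT// powRr1// ltW.
rewrite (powRM _ (ltW t0) a0) (powRM _ A0) ?invr_ge0 ?(ltW t0)// tV tqr tq1.
by field; rewrite !tp tN0.
Qed.

End RealEstimates.

(** * Estimates for the two steps of Bregman iteration *)

Section Estimates.
Context {R : realType} {X Y : normedModType R}.
Implicit Types (T : {linear X -> Y}) (Reg : X -> \bar R) (g : Y) (f : X).

(** The functional from the optimality condition gives equality in Young's inequality for both
    terms, so its dual value is minus the primal one; [p1] does at least as well. *)
Lemma strong_duality (q r : R) T (cT : continuous T) Reg alpha g
    (f1 : X) (p1 : dual Y) :
  1 < q -> smooth_and_convex Y q r -> proper_fun Reg -> econvex_function Reg ->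
  0 < alpha -> minimizer (tikhonov T (norm_power q) alpha g Reg) f1 ->
  minimizer (dual_tikhonov cT (norm_power q) Reg alpha g) p1 ->
  Reg f1 \is a fin_num /\
  (dual_tikhonov cT (norm_power q) Reg alpha g p1 <=
    - tikhonov T (norm_power q) alpha g Reg f1)%E.
Proof.
move=> q1 sm pR cR a0 min1 dmin.
have [p2 [s1 s2]] := tikhonov_optimality cT q1 sm pR cR a0 min1.
have [R1 _] := s1; split => //; apply: le_trans (dmin p2) _.
rewrite /dual_tikhonov/tikhonov/norm_power in s2 *.
rewrite (fenchel_subdiff s1) (fenchel_subdiff s2) -(fineK R1).
rewrite -?EFinB -?EFinM -?EFinB -?EFinD -?EFinN lee_fin.
have -> : (adjoint cT p2) f1 = p2 (T f1) by [].
have -> : (- alpha *: p2) (T f1 - g) = - (alpha * p2 (T f1 - g)).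
  by rewrite -mulNr.
by rewrite mulrBr mulrN mulKf ?gt_eqF// linearB/=; lra.
Qed.

(** Sum of four inequalities: duality, Young's inequality for [Reg] at [ft], and the two Bregman
    lower bounds divided by [alpha]. By [alpha^qs = t alpha] the dual one acquires the weight
    [t]. *)
Lemma first_step_estimate (q qs r cq cqs : R) T (cT : continuous T) Reg alpha t
    (g : Y) (f1 ft w : X) (p1 p : dual Y) :
  1 < q -> smooth_and_convex Y q r -> proper_fun Reg -> econvex_function Reg ->
  0 < alpha -> 0 < t -> t `^ (q - 1) = alpha -> alpha `^ qs = t * alpha ->
  (forall (x y : Y) (ys : dual Y), subdiff (norm_power q) y ys ->
     ((cq * Num.max `|y| `|x - y| `^ (q - r) * `|x - y| `^ r)%:E
       <= bregman (norm_power q) ys x y)%E) ->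
  (forall (x y : dual Y) (yss : dual (dual Y)),
     subdiff (fenchel (norm_power q)) y yss ->
     ((cqs * `|x - y| `^ qs)%:E <= bregman (fenchel (norm_power q)) yss x y)%E) ->
  minimizer (tikhonov T (norm_power q) alpha g Reg) f1 ->
  minimizer (dual_tikhonov cT (norm_power q) Reg alpha g) p1 ->
  subdiff (norm_power q) (T w) p ->
  Reg ft \is a fin_num ->
  let d := `|T f1 - g + t *: T w| in
  cq * Num.max (t * `|T w|) d `^ (q - r) * d `^ r / alpha
    + cqs * (t * `|p1 - p| `^ qs)
  <= fine (Reg ft) - fine (Reg f1) + p (T f1 - T ft)
     + (p1 (g - (T ft + t *: T w)) - p (g - (T ft + t *: T w))).
Proof.
move=> q1 sm pR cR a0 t0 ta aqs HS HSs min1 dmin sp Rt /=.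
set d := `|_ + t *: T w|.
have [R1 dual] := strong_duality q1 sm pR cR a0 min1 dmin.
have := subdiff_norm_powerZ q1 t0 sp; rewrite ta.
set y := - (t *: T w); set pa := - alpha *: p => spa.
have := HS (T f1 - g) y pa spa.
have := HSs (- alpha *: p1) pa _ (subdiff_fenchel spa).
have := fenchel_ge Reg (adjoint cT p1) ft.
move: dual; rewrite /dual_tikhonov/tikhonov/bregman (fenchel_subdiff spa).
rewrite /norm_power -(fineK R1) -(fineK Rt).
set r1 := fine (Reg f1); set rt := fine (Reg ft).
have aN0 : alpha != 0 by rewrite gt_eqF.
have pw (l : dual Y) : l y = - (t * l (T w)) by rewrite linearN linearZ.
have -> : pa y = alpha * (t * p (T w)).
  by rewrite (_ : pa y = - alpha * p y)// pw mulrNN.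
have -> : pa (T f1 - g - y) = - (alpha * (p (T f1) - p g + t * p (T w))).
  rewrite (_ : pa _ = - alpha * p (T f1 - g - y))//.
  by rewrite !linearB/= pw opprK mulNr.
have -> : evaluation y (- alpha *: p1 - pa) =
    alpha * (t * (p1 (T w) - p (T w))).
  rewrite (_ : evaluation y _ = - alpha * p1 y - - alpha * p y)//.
  by rewrite !pw; ring.
have -> : `|- alpha *: p1 - pa| = alpha * `|p1 - p|.
  by rewrite -scalerBr normrZ normrN gtr0_norm.
have -> : `|y| = t * `|T w| by rewrite normrN normrZ gtr0_norm.
have -> : T f1 - g - y = T f1 - g + t *: T w by rewrite opprK.
rewrite -/d.
have -> : adjoint cT p1 ft = p1 (T ft) by [].
have lin (l : dual Y) : l (g - (T ft + t *: T w)) =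
    l g - (l (T ft) + t * l (T w)).
  by rewrite linearB linearD linearZ.
rewrite !lin (linearB p) powRM ?(ltW a0)// aqs.
(* For either conjugate, [-oo] contradicts the lower bounds and [+oo] the duality inequality. *)
move: (fenchel _ (- alpha *: p1)) (fenchel Reg _) => [fs| |] [fr| |] //.
  rewrite -?EFinN -?EFinB -?EFinM -?EFinD -?EFinN -?EFinB -?EFinD !lee_fin.
  set m := cq * _ `^ (q - r) * _; set Sx := `|_ - g| `^ q; set Sy := _ `^ q.
  move=> h1 h2; rewrite -(ler_pM2l (_ : 0 < alpha^-1)) ?invr_gt0// => h3.
  rewrite -(ler_pM2l (_ : 0 < alpha^-1)) ?invr_gt0// => h4.
  rewrite !/fine.
  have Va u : alpha^-1 * (alpha * u) = u by rewrite mulKf.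
  have := Va (t * p (T w)); have := Va (t * p1 (T w)).
  have := Va (cqs * (t * `|p1 - p| `^ qs)); have := Va (p (T f1)).
  have := Va (p g); lra.
by rewrite gt0_muley ?lte_fin ?invr_gt0.
by rewrite gt0_muley ?lte_fin ?invr_gt0.
Qed.

(** Comparing [f1] with [fd] and using the subgradient at [fd] leaves [p h], [h = T fd - T f1]. The
    subgradient inequality at [T w] with increment [(k t)^-1 h] bounds it; [t^q = t alpha] yields
    the stated scaling. *)
Lemma residual_estimate (q k : R) T (cT : continuous T) Reg alpha t (g : Y)
    (f1 fd w : X) (p : dual Y) :
  1 < q -> 0 < alpha -> 0 < t -> t `^ (q - 1) = alpha -> 0 < k ->
  minimizer (tikhonov T (norm_power q) alpha g Reg) f1 ->
  Reg f1 \is a fin_num -> subdiff Reg fd (adjoint cT p) ->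
  subdiff (norm_power q) (T w) p ->
  `|T f1 - g| `^ q <=
    `|T fd - g| `^ q + k * (t * `|T w| + k^-1 * `|T fd - T f1|) `^ q.
Proof.
move=> q1 a0 t0 ta k0 min1 R1 [Rd sR] /subdiff_norm_powerP sp.
have kt : 0 < k * t by rewrite mulr_gt0.
have tq : 0 < t `^ q by rewrite powR_gt0.
have tqE : t `^ q = t * alpha by rewrite -ta mulr_powRB1 ?(ltW t0)//; lra.
set h := T fd - T f1.
have := sp (T w + (k * t)^-1 *: h); rewrite [T w + _ - _]addrAC subrr add0r.
have -> : p ((k * t)^-1 *: h) = (k * t)^-1 * p h by rewrite linearZ.
have qV0 : 0 < q^-1 by rewrite invr_gt0; lra.
have hn : `|T w + (k * t)^-1 *: h| `^ q <=
    (t * `|T w| + k^-1 * `|h|) `^ q / t `^ q.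
  rewrite ler_pdivlMr// -powRM ?(ltW t0)//.
  have -> : `|T w + (k * t)^-1 *: h| * t = `|t *: (T w + (k * t)^-1 *: h)|.
    by rewrite normrZ gtr0_norm// mulrC.
  apply: ge0_ler_powR; rewrite ?nnegrE//; first by lra.
    by rewrite addr_ge0// mulr_ge0 ?invr_ge0// ltW.
  rewrite scalerDr scalerA invfM mulrCA mulfV ?gt_eqF// mulr1.
  apply: le_trans (ler_normD _ _) _.
  by rewrite !normrZ gtr0_norm// gtr0_norm ?invr_gt0.
rewrite -(ler_pM2l qV0) in hn.
have := min1 fd; have := sR f1.
rewrite /tikhonov/norm_power -(fineK R1) -(fineK Rd).
have -> : adjoint cT p (f1 - fd) = - p h by rewrite -linearN opprB -linearB.
rewrite -!EFinM -!EFinD !lee_fin.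
set rd := fine _; set r1 := fine _; set z := (_ + k^-1 * _) `^ q in hn *.
move=> h1 h2 h3.
have {h3} : (k * t)^-1 * p h <= q^-1 * (z / t `^ q).
  apply: le_trans hn; have := powR_ge0 `|T w| q.
  by rewrite -(pmulr_rge0 _ qV0); lra.
rewrite ler_pdivrMl// tqE => h3.
have h4 : q^-1 * (z * k) / alpha = k * t * (q^-1 * (z / (t * alpha))).
  by field; rewrite !gt_eqF//; lra.
have aV : 0 < alpha^-1 * q^-1 by rewrite mulr_gt0// invr_gt0.
rewrite -(ler_pM2l aV) mulrDr; lra.
Qed.

(** Minimality of [f2] tested with [fd]; all terms involving [f1] cancel. *)
Lemma second_step_estimate (q : R) T (cT : continuous T) Reg alpha (g : Y)
    (f1 f2 fd : X) (p1 p : dual Y) : proper_fun Reg ->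
  Reg f1 \is a fin_num -> Reg fd \is a fin_num ->
  minimizer (tikhonov T (norm_power q) alpha g
    (bregman Reg (adjoint cT p1) ^~ f1)) f2 ->
  (bregman Reg (adjoint cT p) f2 fd <=
    (alpha^-1 * (q^-1 * `|T fd - g| `^ q) - alpha^-1 * (q^-1 * `|T f2 - g| `^ q)
     + (p1 (T f2 - T fd)%R - p (T f2 - T fd)%R))%:E)%E.
Proof.
move=> [RN _] R1 Rd /(_ fd); have := RN f2.
rewrite /tikhonov/bregman/norm_power.
have -> : adjoint cT p1 (f2 - f1) = p1 (T f2) - p1 (T f1).
  by rewrite -linearB -linearB.
have -> : adjoint cT p1 (fd - f1) = p1 (T fd) - p1 (T f1).
  by rewrite -linearB -linearB.
have -> : adjoint cT p (f2 - fd) = p (T f2) - p (T fd).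
  by rewrite -linearB -linearB.
rewrite (linearB p1) (linearB p).
rewrite -(fineK R1) -(fineK Rd); case: (Reg f2) => [r2| |] // _.
by rewrite -!EFinM -!EFinB -!EFinD !lee_fin; lra.
Qed.

End Estimates.

(** * The error bound for the second iterate *)

Theorem theorem4p5 (R : realType) (q qs r c cqY cqsYs : R)
    (q_gt1 : 1 < q) (q_le2 : q <= 2) (r_ge2 : 2 <= r)
    (qqs : q^-1 + qs^-1 = 1)
    (c_gt0 : 0 < c) (cqY_gt0 : 0 < cqY) (cqsYs_gt0 : 0 < cqsYs) :
  exists C Ct : R, [/\ 0 < C, 0 < Ct &
    forall (X Y : completeNormedModType R)
      (T : {linear X -> Y}) (cT : continuous T)
      (Reg : X -> \bar R) (alpha : R) (gobs : Y)
      (fd : X) (Phi : R -> R)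
      (p : dual Y) (w : X) (beta mu tbar delta : R)
      (f1 : X) (p1 : dual Y) (f2 : X),
    let S : Y -> \bar R := norm_power q in
    (* setting *)
    injective T ->
    (forall Tinv : Y -> X, cancel T Tinv ->
       ~ {within range T, continuous Tinv}) ->
    smooth_and_convex Y q r ->
    proper_fun Reg -> econvex_function Reg -> lower_semicontinuous Reg ->
    0 < alpha ->
    (forall (f0 : X) (f0s : dual X), subdiff Reg f0 f0s ->
       exists! f : X,
         minimizer (tikhonov T S alpha gobs (bregman Reg f0s ^~ f0)) f) ->
    (* c_{q,Y} and c_{q^*,Y^*} *)
    (forall (x y : Y) (ys : dual Y), subdiff S y ys ->
       ((cqY * Num.max `|y| `|x - y| `^ (q - r) * `|x - y| `^ r)%:E
         <= bregman S ys x y)%E) ->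
    (forall (x y : dual Y) (yss : dual (dual Y)), subdiff (fenchel S) y yss ->
       ((cqsYs * `|x - y| `^ qs)%:E <= bregman (fenchel S) yss x y)%E) ->
    (* Bregman iteration *)
    minimizer (tikhonov T S alpha gobs Reg) f1 ->
    minimizer (dual_tikhonov cT S Reg alpha gobs) p1 ->
    minimizer (tikhonov T S alpha gobs (bregman Reg (adjoint cT p1) ^~ f1)) f2 ->
    (* source condition, noise level and parameter choice *)
    index_function Phi ->
    VSC3 cT S Reg q fd Phi p w beta mu tbar ->
    `|gobs - T fd| <= delta -> 0 < delta ->
    c^-1 * delta <= alpha `^ (qs - 1) -> alpha `^ (qs - 1) <= tbar ->
    let Phit : R -> R := fun s => Phi (s `^ (q / r)) in
    (bregman Reg (adjoint cT p) f2 fd <=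
      C%:E * ((delta `^ q / alpha)%:E
        + (alpha `^ (2 * (qs - 1)))%:E
          * neg_conjugate Phit
              (Ct * (c + `|T w|) `^ (q - r) / - (alpha `^ (qs - 1)))%R
        + (beta * alpha `^ (2 * mu * (qs - 1)))%:E))%E].
Proof.
have [qs1 qqs1] := conjugate_exponent q_gt1 qqs.
have [k k1 kP] := absorb_power q_gt1.
(* Half of the dual term absorbs the noise; the other half remains to control [t B^qs]. *)
have hcqs : 0 < cqsYs / 2 by rewrite divr_gt0.
have [C1 C10 C1P] := young_small q_gt1 qqs hcqs.
have k10 : 0 < k + 1 by lra.
have k0 : 0 < k by lra.
have q_le_r : q <= r by lra.
have q0 : 0 < q by lra.
have qs0 : 0 < qs by lra.
have rN0 : r != 0 by rewrite gt_eqF//; lra.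
have qr0 : q / r != 0 by rewrite gt_eqF// divr_gt0//; lra.
have qV1 : q^-1 <= 1 by rewrite invf_le1//; lra.
have qsV1 : qs^-1 <= 1 by rewrite invf_le1//; lra.
(* The coefficient from [power_tradeoff], where [k + 1] bounds the maximum relative to [N]. *)
pose C2 := cqY * (k + 1) `^ (q - r).
have C20 : 0 < C2 by rewrite mulr_gt0// powR_gt0.
have C0 : 0 <= 4 / cqsYs * (1 + C1 + C2).
  by rewrite mulr_ge0 ?divr_ge0 ?(ltW cqsYs_gt0)//; lra.
exists (2 + 4 / cqsYs * (1 + C1 + C2)), (C2 / 2 `^ r); split.
- by rewrite ltr_wpDr.
- by rewrite divr_gt0// powR_gt0.
move=> X Y T cT Reg alpha gobs fd Phi p w beta mu tbar delta f1 p1 f2 S.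
move=> _ _ sm pR cR _ a0 _ HS HSs min1 dmin min2 [Phi0 _ _ _].
move=> [[beta0 mu1 tbar0] sfd sp [fs Hfs]] noise delta0.
set t := alpha `^ (qs - 1) => ct ttbar /=.
have t0 : 0 < t by rewrite powR_gt0.
have ta : t `^ (q - 1) = alpha by rewrite -powRrM mulrC qqs1 powRr1// ltW.
have aqs : alpha `^ qs = t * alpha by rewrite mulrC mulr_powRB1 ?(ltW a0).
have tt : 0 < t <= tbar by rewrite t0.
have [[Rt _] vsc] := Hfs t tt.
have {}sp := subdiff_of_fenchel_norm_power q_gt1 sm sp.
have [R1 _] := strong_duality q_gt1 sm pR cR a0 min1 dmin.
have [Rd _] := sfd.
have Tft : T (fd - t *: w) + t *: T w = T fd by rewrite linearB linearZ subrK.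
have := first_step_estimate q_gt1 sm pR cR a0 t0 ta aqs HS HSs min1 dmin sp Rt.
rewrite Tft /=; set d := `|T f1 - gobs + t *: T w|; set W := `|T w|.
set B := `|p1 - p|; set ft := fd - t *: w => first_step.
have Bd (y : Y) : p1 y - p y <= B * `|y|.
  exact: le_trans (ler_norm _) (dual_norm_le (p1 - p) y).
have W0 : 0 <= W := normr_ge0 _.
have cW : 0 < c + W by rewrite ltr_pwDl.
pose N := t * (c + W); have N0 : 0 < N by rewrite mulr_gt0.
have deltaN : delta <= N.
  move: ct; rewrite ler_pdivrMl// => /le_trans; apply.
  by rewrite mulrC ler_pM2l// lerDl.
have tWN : t * W <= N by rewrite ler_pM2l// lerDr ltW.
have noise' : `|T fd - gobs| <= delta by rewrite distrC.
(* Both [delta] and [t W] are at most [N], which brings the residual estimate into the form that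
   [absorb_power] resolves. *)
have resid : `|T f1 - gobs| <= k * N.
  apply: kP; rewrite ?(ltW N0)//.
  have := residual_estimate q_gt1 a0 t0 ta k0 min1 R1 sfd sp.
  move=> /le_trans; apply; apply: lerD.
    apply: ge0_ler_powR; rewrite ?nnegrE ?(ltW N0) ?(ltW q0)//.
    exact: le_trans deltaN.
  rewrite ler_pM2l//; apply: ge0_ler_powR; rewrite ?nnegrE ?(ltW q0)//.
  - by rewrite addr_ge0// mulr_ge0 ?invr_ge0// ltW.
  - by rewrite addr_ge0 ?mulr_ge0 ?invr_ge0 ?addr_ge0// ltW.
  apply: lerD => //; rewrite ler_pM2l ?invr_gt0//.
  have -> : T fd - T f1 = (T fd - gobs) - (T f1 - gobs).
    by rewrite opprB addrA subrK.
  apply: le_trans (ler_normB _ _) _; rewrite addrC lerD2l.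
  exact: le_trans deltaN.
have d0 : 0 <= d := normr_ge0 _.
have dN : d <= (k + 1) * N.
  apply: le_trans (ler_normD _ _) _; rewrite normrZ gtr0_norm// -/W.
  by rewrite mulrDl mul1r lerD.
set A := `|T f1 - T fd + t *: T w|.
have A0 : 0 <= A := normr_ge0 _.
have Ad : A <= d + delta.
  rewrite /A; have -> : T f1 - T fd + t *: T w =
      T f1 - gobs + t *: T w + (gobs - T fd).
    by rewrite addrAC [RHS]addrAC addrA subrK [LHS]addrAC.
  by apply: le_trans (ler_normD _ _) _; rewrite lerD2l.
have mN : Num.max (t * W) d <= (k + 1) * N.
  rewrite ge_max dN andbT mulrDl mul1r ler_wpDl//.
  by rewrite mulr_ge0 ?(ltW k0) ?(ltW N0).
have dm : d <= Num.max (t * W) d by rewrite le_max lexx orbT.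
have := power_tradeoff q_gt1 q_le_r cqY_gt0 k10 N0 d0 (ltW delta0) deltaN
  A0 Ad dm mN.
have := power_rescale q r t0 (ltW cW) A0; rewrite -/N ta => resc tradeoff.
(* The test point of the conjugate: [Phit tau] is the value of [Phi] in the source condition, and
   [t^2 x tau] is minus the power of [A] gained from the convexity of [S]. *)
pose tau := (A / t) `^ r; pose x := C2 / 2 `^ r * (c + W) `^ (q - r) / - t.
pose Phit s := Phi (s `^ (q / r)).
(* The point 0 makes the conjugate nonnegative, so that the factors in front of
   the three terms of the bound can be raised to a common constant. *)
pose m := Num.max 0 (x * tau + Phit tau).
have conj_ge : (m%:E <= neg_conjugate Phit x)%E.
  rewrite /m EFin_max ge_max; apply/andP; split; apply: ereal_sup_ubound.
    by exists 0 => //=; rewrite mulr0 /Phit powR0// Phi0 addr0.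
  by exists tau => //=; exact: powR_ge0.
have PhiE : Phi (t `^ (- q) * A `^ q) = Phit tau.
  congr Phi; rewrite /tau -powRrM mulrCA mulfV// mulr1.
  rewrite powRM ?invr_ge0 ?(ltW t0)//.
  by rewrite -(powR_inv1 (ltW t0)) -powRrM mulN1r mulrC.
have source : p (T f1 - T ft) <= fine (Reg f1) - fine (Reg ft) +
    (t ^+ 2 * Phit tau + beta * t `^ (2 * mu)).
  have := vsc f1; rewrite /bregman -(fineK R1) -(fineK Rt) -/ft -/A PhiE.
  rewrite [X in (X%:E <= _)%E](_ : _ = fs t (ft - f1) - p (T (ft - f1)))//.
  rewrite -[f1 - ft]opprB (linearN (fs t)) -?EFinB -?EFinD lee_fin.
  rewrite -[T f1 - T ft]opprB (linearN p) -linearB/=.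
  by clear; lra.
have B0 : 0 <= B := normr_ge0 _.
have young_B := C1P t B delta t0 B0 (ltW delta0); rewrite ta in young_B.
have pnoise := Bd (gobs - T fd).
have {}pnoise : p1 (gobs - T fd) - p (gobs - T fd) <= B * delta.
  by apply: le_trans pnoise _; rewrite ler_wpM2l.
have aV : 0 < alpha^-1 by rewrite invr_gt0.
have xE : x * tau * t ^+ 2 =
    - (C2 / 2 `^ r * (N `^ (q - r) * A `^ r / alpha)).
  rewrite resc /x /tau; field.
  by rewrite !gt_eqF// powR_gt0.
move: tradeoff; rewrite -/C2 -(ler_pM2l aV) => tradeoff.
have mge : t ^+ 2 * (x * tau + Phit tau) <= t ^+ 2 * m.
  by rewrite ler_pM2l ?exprn_gt0// le_max lexx orbT.
have m0 : 0 <= t ^+ 2 * m.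
  by rewrite mulr_ge0 ?exprn_ge0 ?(ltW t0)// le_max lexx.
set b := beta * t `^ (2 * mu) in source.
have b0 : 0 <= b by rewrite mulr_ge0 ?powR_ge0.
set E := delta `^ q / alpha in young_B; have E0 : 0 <= E.
  by rewrite mulr_ge0 ?powR_ge0// ltW.
set Q := t * B `^ qs in young_B first_step.
have Q0 : 0 <= Q by rewrite mulr_ge0 ?powR_ge0// ltW.
(* The term [C1 E] comes from absorbing [B delta], [C2 E] from replacing [d] by [A]. *)
have QE : cqsYs / 2 * Q <= t ^+ 2 * m + b + (C1 + C2) * E.
  rewrite /E in young_B *.
  by clear -first_step source pnoise young_B tradeoff xE mge; lra.
have {}QE : Q <= 2 / cqsYs * ((1 + C1 + C2) * (E + t ^+ 2 * m + b)).
  rewrite -ler_pdivrMl ?divr_gt0// invf_div.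
  have prod0 : 0 <= (C1 + C2) * (t ^+ 2 * m + b).
    by apply: mulr_ge0; rewrite addr_ge0// ltW.
  by clear -QE E0 prod0; lra.
(* With [lam = 1] the residual power keeps exactly the weight [q^-1 / alpha] of the data term, so
   the two cancel in the second step. *)
have young2 : B * `|T f2 - gobs| <= Q + q^-1 * (`|T f2 - gobs| `^ q / alpha).
  have := young_scaled q_gt1 qqs ltr01 t0 B0 (normr_ge0 (T f2 - gobs)).
  rewrite !powR1 ta -/Q !mul1r => /le_trans; apply.
  by rewrite lerD2r ler_piMl.
have young3 : B * delta <= Q + E.
  have := young_scaled q_gt1 qqs ltr01 t0 B0 (ltW delta0).
  rewrite !powR1 ta -/Q -/E !mul1r => /le_trans; apply.
  by apply: lerD; rewrite ler_piMl.
have B2 : p1 (T f2 - T fd) - p (T f2 - T fd) <= B * `|T f2 - gobs| + B * delta.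
  apply: le_trans (Bd _) _; rewrite -mulrDr ler_wpM2l//.
  have -> : T f2 - T fd = (T f2 - gobs) + (gobs - T fd) by rewrite addrA subrK.
  by apply: le_trans (ler_normD _ _) _; rewrite lerD2l.
have noise_q : alpha^-1 * (q^-1 * `|T fd - gobs| `^ q) <= E.
  rewrite /E mulrC ler_pM2r//.
  apply: le_trans (_ : `|T fd - gobs| `^ q <= _).
    by rewrite ler_piMl ?powR_ge0.
  by apply: ge0_ler_powR; rewrite ?nnegrE ?(ltW delta0) ?(ltW q0).
have step2 := second_step_estimate p pR R1 Rd min2.
apply: le_trans step2 _.
(* After the cancellation [2 E + 2 Q] remains, which explains the constant. *)
apply: (@le_trans _ _
  ((2 + 4 / cqsYs * (1 + C1 + C2)) * (E + t ^+ 2 * m + b))%:E).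
  rewrite lee_fin.
  have mb0 : 0 <= t ^+ 2 * m + b by rewrite addr_ge0.
  by clear -mb0 QE E0 young2 young3 B2 noise_q; lra.
rewrite EFinM lee_wpmul2l ?lee_fin//.
  by rewrite addr_ge0.
have -> : alpha `^ (2 * (qs - 1)) = t ^+ 2.
  by rewrite (mulrC 2) powRrM powR_mulrn ?ltW.
have -> : alpha `^ (2 * mu * (qs - 1)) = t `^ (2 * mu).
  by rewrite (mulrC _ (qs - 1)) (powRrM alpha).
rewrite -/b !EFinD [(t ^+ 2 * m)%:E]EFinM; apply: leeD => //; apply: leeD => //.
by rewrite lee_wpmul2l// lee_fin exprn_ge0// ltW.
Qed.
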